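(* Let $e\geq 2$ and let $\Gamma_e=VO^+(2e,2)$, realised on the set of all $2\times e$ matrices over $\mathbb{F}_2$. Let $W_1$ be the set of matrices whose second row is zero; let $W_2$ be the set of matrices whose entry in position $(1,e)$ is $0$ and whose second row is zero except possibly in position $(2,e)$; let $v$ be the matrix with entry $1$ in position $(2,e-1)$ and $0$ elsewhere. Let $\Gamma_{e,1}$ be the graph obtained from $\Gamma_e$ by first switching the edges between $W_1$ and $v+W_1$, and then switching the edges between $W_2$ and $v+W_2$. Then $\Gamma_{e,1}$ is a strictly Neumaier graph that is edge-regular with parameters $$\bigl(2^{2e},\ (2^{e-1}+1)(2^e-1),\ 2(2^{e-2}+1)(2^{e-1}-1)\bigr)$$ and contains a $2^{e-1}$-regular $2^e$-clique. Further, with $\mu=2^{e-1}(2^{e-1}+1)$, the numbers of common neighbours of pairs of distinct non-adjacent vertices of $\Gamma_{e,1}$ take exactly the values $\mu-2^{e-1}$, $\mu$ and $\mu+2^{e-1}$.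
   Context: All graphs are finite, simple and undirected. For a $2\times e$ matrix $x=(x_{ij})$ over $\mathbb{F}_2$ define $Q(x)=\sum_{j=1}^{e} x_{1j}x_{2j}$ (the scalar product of its two rows; equivalently the hyperbolic quadratic form $x_1x_2+x_3x_4+\dots+x_{2e-1}x_{2e}$ on $\mathbb{F}_2^{2e}$). The affine polar graph $VO^+(2e,2)$ has vertex set the $2\times e$ matrices over $\mathbb{F}_2$, two distinct matrices $x,y$ adjacent iff $Q(x-y)=0$; it is strongly regular with parameters $(2^{2e},(2^{e-1}+1)(2^e-1),2(2^{e-2}+1)(2^{e-1}-1),2^{e-1}(2^{e-1}+1))$. For a set $X$ of matrices and a matrix $v$, $v+X=\{v+x: x\in X\}$. For disjoint vertex sets $S,T$ of a graph, switching the edges between $S$ and $T$ means: for each $x\in S$ and each $t\in T$, delete the edge $xt$ if present and insert it if absent. A graph on $v$ vertices is edge-regular with parameters $(v,k,\lambda)$ if it has at least one edge, is $k$-regular, and every two adjacent vertices have exactly $\lambda$ common neighbours; it is strongly regular if additionally it is non-complete and any two distinct non-adjacent vertices have a constant number of common neighbours. A clique $S$ in a regular graph is $m$-regular if every vertex outside $S$ is adjacent to exactly $m>0$ vertices of $S$. A strictly Neumaier graph is a non-complete edge-regular graph containing a regular clique which is not strongly regular. *)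

(* Defs.v *)
From mathcomp Require Export all_boot all_algebra.

Set Implicit Arguments.
Unset Strict Implicit.
Unset Printing Implicit Defensive.

Import GRing.Theory.

Section Graphs.

(* A graph on T is given by its adjacency relation; being simple and undirected
   is the predicate [simple_graph], which is part of [edge_regular]. *)
Variables (T : finType) (E : rel T).

Definition simple_graph : Prop := symmetric E /\ irreflexive E.

Definition nbrs (x : T) : {set T} := [set y | E x y].

Definition common_nbrs (x y : T) : {set T} := nbrs x :&: nbrs y.

Definition complete_graph : Prop := forall x y, x != y -> E x y.

Definition regular_graph (k : nat) : Prop := forall x, #|nbrs x| = k.

Definition edge_regular (v k l : nat) : Prop :=
  [/\ simple_graph, #|T| = v, exists x y, E x y, regular_graph k
    & forall x y, E x y -> #|common_nbrs x y| = l].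

Definition strongly_regular : Prop :=
  exists v k l mu,
    [/\ edge_regular v k l, ~ complete_graph
      & forall x y, x != y -> ~~ E x y -> #|common_nbrs x y| = mu].

Definition clique (S : {set T}) : Prop :=
  {in S &, forall x y, x != y -> E x y}.

Definition regular_clique (S : {set T}) (m : nat) : Prop :=
  [/\ clique S, 0 < m & forall x, x \notin S -> #|nbrs x :&: S| = m].

Definition strictly_neumaier : Prop :=
  [/\ exists v k l, edge_regular v k l,
      ~ complete_graph,
      exists S m, regular_clique S m
    & ~ strongly_regular].

(* Intended for disjoint S1 and S2. *)
Definition switch (S1 S2 : {set T}) : rel T :=
  fun x y => E x y (+) ((x \in S1) && (y \in S2) || (x \in S2) && (y \in S1)).

End Graphs.

Section AffinePolar.

Local Open Scope ring_scope.

Variable e : nat.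

Notation mat := 'M['F_2]_(2, e).

Definition Q (x : mat) : 'F_2 := \sum_(j < e) x 0 j * x 1 j.

Definition VOplus : rel mat := fun x y => (x != y) && (Q (x - y) == 0).

Definition translate (v : mat) (X : {set mat}) : {set mat} :=
  [set v + x | x in X].

(* Rows and columns are numbered from 0, so the e-th column is the j : 'I_e with
   j.+1 = e, and column e - 1 the one with j.+2 = e. *)
Definition W1 : {set mat} := [set x : mat | [forall j, x 1 j == 0]].

Definition W2 : {set mat} :=
  [set x : mat | [forall j : 'I_e,
     if j.+1 == e then x 0 j == 0 else x 1 j == 0]].

Definition v0 : mat := \matrix_(i, j) ((i == 1) && (j.+2 == e))%:R.

Definition Gamma1 : rel mat :=
  switch (switch VOplus W1 (translate v0 W1)) W2 (translate v0 W2).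

End AffinePolar.

(* Main.v *)
(** Replace adjacency by the sign matrix [s x z = (-1)^Q(x - z)].  The rows of [s]
    sum to [2^e] and, [Q] being bent, distinct rows are orthogonal, which is
    strong regularity.  Switching negates the entries [s x z] for which
    [flip x z] holds.  Almost every sum that must be evaluated after switching
    vanishes because some translation [z |-> z + t] preserves [flip] and negates
    the summand.  The only pairs [x, y] escaping this lie in the subspace spanned
    by [W1], [W2] and [v0], and [x - y] has both last-column entries equal to 1
    and a zero in position (2, e-1); then [Q (x - y) = 1], [x] and [y] are not
    adjacent, and their rows have inner product [+-2^(e+1)].  The regular clique
    is [W1]. *)

Require Import Defs.
From mathcomp Require Import zify.

Set Implicit Arguments.
Unset Strict Implicit.
Unset Printing Implicit Defensive.

Import GRing.Theory Num.Theory.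

Local Open Scope ring_scope.

(** * Boolean coordinates over ['F_2] *)

Definition bit (a : 'F_2) : bool := a != 0.

Lemma bitD a b : bit (a + b) = bit a (+) bit b.
Proof. by case: a b => [[|[|//]] ?] [[|[|//]] ?]. Qed.

Lemma bitM a b : bit (a * b) = bit a && bit b.
Proof. by case: a b => [[|[|//]] ?] [[|[|//]] ?]. Qed.

Lemma eqF2E (a b : 'F_2) : (a == b) = ~~ (bit a (+) bit b).
Proof. by case: a b => [[|[|//]] ?] [[|[|//]] ?]. Qed.

Lemma bit0 : bit 0 = false. Proof. by []. Qed.
Lemma bit1 : bit 1 = true. Proof. by []. Qed.

Lemma bit_inj : injective bit.
Proof. by move=> a b eqab; apply/eqP; rewrite eqF2E eqab addbb. Qed.

Lemma oppmxF2 m n (x : 'M['F_2]_(m, n)) : - x = x.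
Proof.
by apply/matrixP=> i j; rewrite mxE; apply/eqP; case: (x i j) => [[|[|//]] ?].
Qed.

Lemma addmxF2 m n (x : 'M['F_2]_(m, n)) : x + x = 0.
Proof. by rewrite -{1}[x]oppmxF2 addNr. Qed.

Lemma addmxF2K m n (x y : 'M['F_2]_(m, n)) : x + (x + y) = y.
Proof. by rewrite addrA addmxF2 add0r. Qed.

(** * Sums of signs and the counts they encode *)

Section SignSums.

Variables (T : finType).
Implicit Types (h u : pred T).

(** Reindexing by [g] makes the sum equal to its own negative, and an integer with that property is
    zero. *)
Lemma sum_antisym h (f : T -> int) (g : T -> T) :
  injective g -> (forall z, h (g z) = h z) ->
  (forall z, h z -> f (g z) = - f z) -> \sum_(z | h z) f z = 0.
Proof.
move=> g_inj hg fg; apply/eqP; rewrite -eqNr -sumrN.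
rewrite [eqbRHS](reindex_inj g_inj) /=; under [eqbRHS]eq_bigl do rewrite hg.
by apply/eqP/eq_bigr => z /fg ->.
Qed.

Lemma sum_sign_addb u h :
  \sum_z (-1) ^+ (u z (+) h z)
  = \sum_z (-1) ^+ u z - 2 * \sum_(z | h z) (-1) ^+ u z :> int.
Proof.
rewrite mulr_sumr [X in _ - X]big_mkcond -sumrB; apply: eq_bigr => z _.
by case: (u z); case: (h z).
Qed.

Lemma cardZ h : #|h|%:Z = \sum_(z | h z) 1.
Proof. by rewrite sumr_const natz. Qed.

Lemma sum_sign_card h u :
  2 * #|[pred z | h z && ~~ u z]|%:Z = #|h|%:Z + \sum_(z | h z) (-1) ^+ u z.
Proof.
rewrite !cardZ -big_split /= mulr_sumr big_mkcondr; apply: eq_bigr => z _.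
by case: (u z).
Qed.

(** The product of [1 + (-1) ^+ h z] and [1 + (-1) ^+ u z] is 4 when both Booleans are false and 0
    otherwise. *)
Lemma sum_sign_card2 h u :
  4 * #|[pred z | ~~ h z && ~~ u z]|%:Z
  = #|T|%:Z + \sum_z (-1) ^+ h z + \sum_z (-1) ^+ u z
    + \sum_z (-1) ^+ (h z (+) u z).
Proof.
rewrite !cardZ -!big_split /= mulr_sumr big_mkcond; apply: eq_bigr => z _.
by case: (h z); case: (u z).
Qed.

End SignSums.

(** * The quadratic form [Q], its polar form and their sign sums *)

Section Form.

Variable e : nat.
Implicit Types x y z t : 'M['F_2]_(2, e).

(** The polar form of [Q]. *)
Definition Bform x y : 'F_2 := \sum_j (x 0 j * y 1 j + x 1 j * y 0 j).

Lemma QD x y : Q (x + y) = Q x + Q y + Bform x y.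
Proof.
rewrite /Q /Bform -!big_split /=; apply: eq_bigr => j _; rewrite !mxE.
apply: bit_inj; rewrite !(bitD, bitM).
by case: (bit (x 0 j)) (bit (x 1 j)) (bit (y 0 j)) (bit (y 1 j)) => [] [] [] [].
Qed.

Lemma BformDl x y z : Bform (x + y) z = Bform x z + Bform y z.
Proof.
rewrite /Bform -!big_split /=; apply: eq_bigr => j _; rewrite !mxE.
by rewrite !mulrDl addrACA.
Qed.

Lemma Bform_delta0 x j : Bform x (delta_mx 0 j) = x 1 j.
Proof.
rewrite /Bform (bigD1 j) //= big1 => [|k neq_kj]; rewrite !mxE ?eqxx /=.
  by rewrite mulr0 mulr1 add0r addr0.
by rewrite (negPf neq_kj) !mulr0 addr0.
Qed.

Lemma Bform_delta1 x j : Bform x (delta_mx 1 j) = x 0 j.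
Proof.
rewrite /Bform (bigD1 j) //= big1 => [|k neq_kj]; rewrite !mxE ?eqxx /=.
  by rewrite mulr0 mulr1 !addr0.
by rewrite (negPf neq_kj) !mulr0 addr0.
Qed.

Lemma Q0 : Q (0 : 'M_(2, e)) = 0.
Proof. by rewrite /Q big1 // => j _; rewrite mxE mul0r. Qed.

Lemma Q_delta i j : Q (delta_mx i j : 'M_(2, e)) = 0.
Proof.
rewrite /Q big1 // => k _; rewrite !mxE.
by case: (unliftP 0 i) => [i'|] ->; rewrite ?mul0r // mulr0.
Qed.

(** Translation by a singular [t] changes the sign by a linear character only; this drives all later
    cancellations. *)
Lemma bitQ_translate x z t : Q t = 0 ->
  bit (Q (x + (z + t))) = bit (Q (x + z)) (+) bit (Bform x t) (+) bit (Bform z t).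
Proof. by move=> Qt; rewrite addrA (QD (x + z)) Qt addr0 BformDl !bitD addbA. Qed.

(** A nonzero entry is detected by the matrix unit in the same column and the other row, and matrix
    units are singular. *)
Lemma Bform_nondeg x : x != 0 ->
  exists t, Q t = 0 /\ bit (Bform x t).
Proof.
move=> /matrix0Pn[i [j xij]].
case: (unliftP 0 i) xij => [i'|] -> xij.
  exists (delta_mx 0 j); rewrite Q_delta Bform_delta0; split=> //.
  by move: xij; rewrite (_ : lift _ _ = 1) //; apply: val_inj; case: i' => [[|]].
by exists (delta_mx 1 j); rewrite Q_delta Bform_delta1.
Qed.

(* Involution changing one first-row entry, chosen from the second row only. *)
Lemma sum_sign_Q : \sum_(z : 'M_(2, e)) (-1) ^+ bit (Q z) = #|W1 e|%:Z.
Proof.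
rewrite cardZ (bigID (mem (W1 e))) /= [X in _ + X](_ : _ = 0) ?addr0.
  apply: eq_bigr => z; rewrite inE => /forallP z1; rewrite /Q big1 // => j _.
  by rewrite (eqP (z1 j)) mulr0.
pose t z : 'M['F_2]_(2, e) :=
  if [pick j | bit (z 1 j)] is Some j then delta_mx 0 j else 0.
have tE z : t (z + t z) = t z.
  rewrite {1}/t (@eq_pick _ _ (fun j => bit (z 1 j))) // => j.
  by rewrite mxE /t; case: pickP => [k _|_]; rewrite mxE addr0.
apply: (@sum_antisym _ _ _ (fun z => z + t z)).
- by apply: (can_inj (g := fun z => z + t z)) => z; rewrite tE -addrA addmxF2 addr0.
- move=> z; rewrite !inE; congr (~~ _); apply: eq_forallb => j.
  by rewrite mxE /t; case: pickP => [k _|_]; rewrite mxE addr0.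
- move=> z; rewrite inE negb_forall => /existsP[j z1j].
  rewrite QD /t; case: pickP => [k zk|/(_ j)]; last by rewrite /bit z1j.
  rewrite Q_delta addr0 Bform_delta0 bitD zk addbT.
  by case: (bit (Q z)).
Qed.

(** As a function of [z], the exponent is affine with linear part [Bform (x + y)], which is
    nonzero. *)
Lemma sum_sign_Q_pair x y : x != y ->
  \sum_z (-1) ^+ (bit (Q (x + z)) (+) bit (Q (y + z))) = 0 :> int.
Proof.
move=> neq_xy; have /Bform_nondeg[t [Qt]] : x + y != 0.
  by rewrite -[y]oppmxF2 subr_eq0.
rewrite BformDl bitD => Bt.
apply: (@sum_antisym _ _ _ (fun z => z + t)) => //; first exact: addIr.
move=> z _; rewrite !bitQ_translate //.
by move: Bt; case: (bit (Bform x t)) (bit (Bform y t)) (bit (Bform z t)) => [] [] [] //;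
  case: (bit (Q (x + z))) (bit (Q (y + z))) => [] [].
Qed.

(** Such a matrix is determined by its first row, which is arbitrary. *)
Lemma card_graph (f : 'I_e -> 'rV['F_2]_e -> 'F_2) :
  #|[pred z : 'M['F_2]_(2, e) | [forall j, z 1 j == f j (row 0 z)]]| = (2 ^ e)%N.
Proof.
pose g (r : 'rV['F_2]_e) : 'M['F_2]_(2, e) :=
  \matrix_(i, j) if i == 0 then r 0 j else f j r.
have row_g r : row 0 (g r) = r by apply/rowP=> j; rewrite !mxE.
have g_inj : injective g by exact: can_inj row_g.
transitivity #|codom g|; last first.
  by rewrite card_codom // card_mx card_Fp // mul1n.
apply: eq_card => z; rewrite inE; apply/forallP/codomP => [zf|[r ->] j]; last first.
  by rewrite row_g mxE.
exists (row 0 z); apply/matrixP=> i j; rewrite mxE.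
case: (unliftP 0 i) => [i'|] -> /=; last by rewrite mxE.
by rewrite -(eqP (zf j)); congr (z _ j); apply: val_inj; case: i' => [[|]].
Qed.

Lemma card_W1 : #|W1 e| = (2 ^ e)%N.
Proof.
rewrite -(card_graph (fun _ _ => 0)); apply: eq_card => z.
by rewrite !inE.
Qed.

Lemma sum_sign_Q_row x : \sum_z (-1) ^+ bit (Q (x + z)) = (2 ^ e)%:Z.
Proof.
rewrite -card_W1 -sum_sign_Q [RHS](reindex_inj (addrI x)).
by apply: eq_bigr.
Qed.

End Form.

(** * The sign matrix of the switched graph *)

Section Switched.

Variable n : nat.
Implicit Types (x y z t : 'M['F_2]_(2, n.+2)) (i j : 'I_n.+2).

Definition clast : 'I_n.+2 := ord_max.
Definition cpen : 'I_n.+2 := Ordinal (leqnSn n.+1).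

Lemma cpen_clast : cpen == clast = false.
Proof. by rewrite -val_eqE /= ltn_eqF. Qed.

Lemma eq_clast j : (j.+1 == n.+2) = (j == clast). Proof. by []. Qed.
Lemma eq_cpen j : (j.+2 == n.+2) = (j == cpen). Proof. by []. Qed.

(* [W1], [W2] and their translates by [v0] all lie in this subspace. *)
Definition short_row x :=
  [forall j, (j != cpen) && (j != clast) ==> ~~ bit (x 1 j)].

(** A switching affects [x], [z] when they lie on opposite sides, so their second-row [cpen] entries
    differ, and when both have a zero in column [clast]: in the second row for [W1], in the first
    row for [W2]. Being switched twice cancels, hence the outer [(+)]. *)
Definition flip x z :=
  [&& short_row x, short_row z, bit (x 1 cpen) (+) bit (z 1 cpen)
    & (~~ bit (x 1 clast) && ~~ bit (z 1 clast))
      (+) (~~ bit (x 0 clast) && ~~ bit (z 0 clast))].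

(* Non-adjacency in [Gamma1], except that it is false on the diagonal. *)
Definition nadj x z := bit (Q (x + z)) (+) flip x z.

Lemma eq_short_row x y :
  (forall j, j != cpen -> j != clast -> bit (x 1 j) = bit (y 1 j)) ->
  short_row x = short_row y.
Proof.
move=> eqxy; apply: eq_forallb => j; case: eqP => //= /eqP jp.
by case: eqP => //= /eqP jl; rewrite eqxy.
Qed.

Lemma short_rowP x j : short_row x -> j != cpen -> j != clast ->
  bit (x 1 j) = false.
Proof. by move=> /forallP/(_ j)/implyP xj jp jl; rewrite (negPf (xj _)) // jp. Qed.

Lemma v0E : v0 n.+2 = delta_mx 1 cpen.
Proof. by apply/matrixP=> i j; rewrite !mxE eq_cpen. Qed.

Lemma mem_translate t (X : {set 'M['F_2]_(2, n.+2)}) x :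
  (x \in translate t X) = (t + x \in X).
Proof.
apply/imsetP/idP => [[y Xy ->]|Xx]; first by rewrite addmxF2K.
by exists (t + x) => //; rewrite addmxF2K.
Qed.

Lemma mem_W1 x :
  (x \in W1 n.+2) = [&& short_row x, ~~ bit (x 1 cpen) & ~~ bit (x 1 clast)].
Proof.
rewrite inE; apply/forallP/and3P => [x1|[x1 xp xl] j].
  split; rewrite ?(eqP (x1 _)) //; apply/forallP => j.
  by rewrite (eqP (x1 j)) implybT.
rewrite -[_ == _]negbK -/(bit _); case: (eqVneq j cpen) => [-> //|jp].
by case: (eqVneq j clast) => [-> //|jl]; rewrite (short_rowP x1).
Qed.

Lemma mem_W2 x :
  (x \in W2 n.+2) = [&& short_row x, ~~ bit (x 1 cpen) & ~~ bit (x 0 clast)].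
Proof.
rewrite inE; apply/forallP/and3P => [x1|[x1 xp xl] j].
  split; [apply/forallP=> j | move: (x1 cpen) | move: (x1 clast)].
  - apply/implyP=> /andP[_ jl]; move: (x1 j).
    by rewrite eq_clast (negPf jl) /bit negbK.
  - by rewrite eq_clast cpen_clast /bit negbK.
  - by rewrite eq_clast eqxx /bit negbK.
rewrite eq_clast; case: (eqVneq j clast) => [-> |jl];
  rewrite -[_ == _]negbK -/(bit _) //.
by case: (eqVneq j cpen) => [-> //|jp]; rewrite (short_rowP x1).
Qed.

(** Adding [v0] changes only the second-row [cpen] entry, so all the membership tests reduce to
    [short_row] and three entries of each matrix, and a finite check remains. *)
Lemma Gamma1E x z : Gamma1 x z = (x != z) && ~~ nadj x z.
Proof.
rewrite /Gamma1 /switch /VOplus !mem_translate !mem_W1 !mem_W2 v0E.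
have Kv y : short_row (delta_mx 1 cpen + y) = short_row y.
  by apply: eq_short_row => j jp jl; rewrite !mxE (negPf jp) andbF add0r.
rewrite !Kv !mxE !eqxx /= ![_ == cpen]eq_sym cpen_clast /= !add0r !bitD bit1.
rewrite /nadj /flip oppmxF2 -[Q _ == 0]negbK -/(bit _).
have [->|_] /= := eqVneq x z.
  by case: (short_row z) (bit (z 1 cpen)) (bit (z 1 clast)) (bit (z 0 clast))
    => [] [] [] [].
case: (short_row x) (short_row z) (bit (x 1 cpen)) (bit (z 1 cpen)) => [] [] [] [];
case: (bit (x 1 clast)) (bit (z 1 clast)) (bit (x 0 clast)) (bit (z 0 clast))
  => [] [] [] []; by case: (bit (Q (x + z))).
Qed.

Lemma nadjxx x : nadj x x = false.
Proof. by rewrite /nadj addmxF2 /flip Q0 addbb !andbF. Qed.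

Lemma nadj_neq x y : nadj x y -> x != y.
Proof. by apply: contraTneq => ->; rewrite nadjxx. Qed.

Lemma flipC x z : flip x z = flip z x.
Proof.
rewrite /flip andbCA [bit (x 1 cpen) (+) _]addbC.
by rewrite ![~~ bit (x _ _) && _]andbC.
Qed.

Lemma nadjC x z : nadj x z = nadj z x.
Proof. by rewrite /nadj addrC flipC. Qed.

Lemma flip_delta0 x z j : j != clast -> flip x (z + delta_mx 0 j) = flip x z.
Proof.
move=> jl; rewrite /flip (@eq_short_row (z + _) z) => [|k _ _]; rewrite !mxE ?addr0 //.
by rewrite [clast == j]eq_sym (negPf jl) /= !addr0.
Qed.

(** * Row sums, sums over the clique, and inner products of rows *)

Lemma row_sum x : \sum_z (-1) ^+ nadj x z = (2 ^ n.+2)%:Z.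
Proof.
rewrite sum_sign_addb sum_sign_Q_row (@sum_antisym _ _ _ (+%R^~ (delta_mx 0 cpen))).
- by rewrite mulr0 subr0.
- exact: addIr.
- by move=> z; rewrite flip_delta0 ?cpen_clast.
(* Where [flip x z] holds, the second-row [cpen] entries differ, so this translation negates the
   sign. *)
move=> z /and4P[_ _ dp _]; rewrite bitQ_translate ?Q_delta // !Bform_delta0 -addbA.
by rewrite dp addbT; case: (bit (Q _)).
Qed.

(** Some second-row entry of [x] is 1, say in column [j]; translation by [delta_mx 0 j] preserves
    [W1] and negates the sign of [Q]. It preserves [flip] if [j] is not [clast]. If [clast] is the
    only choice, [x] has a zero at [cpen], as does every matrix of [W1], and [flip x] vanishes on
    [W1]. *)
Lemma W1_sum x : x \notin W1 n.+2 -> \sum_(z in W1 n.+2) (-1) ^+ nadj x z = 0 :> int.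
Proof.
move=> xW; have [j zj|nj] := pickP (fun j => (j != clast) && bit (x 1 j)).
  case/andP: zj => jl xj.
  apply: (@sum_antisym _ _ _ (+%R^~ (delta_mx 0 j))); first exact: addIr.
    by move=> z; rewrite !inE; apply: eq_forallb => k; rewrite !mxE addr0.
  move=> z; rewrite inE => /forallP zW; rewrite /nadj flip_delta0 //.
  rewrite bitQ_translate ?Q_delta // !Bform_delta0 (eqP (zW j)) xj addbT addbF.
  by case: (bit (Q _)); case: flip.
have xl : bit (x 1 clast).
  apply: contraR xW => xl; rewrite inE; apply/forallP => j.
  rewrite -[_ == _]negbK -/(bit _); have [-> //|jl] := eqVneq j clast.
  by move: (nj j); rewrite jl /= => ->.
have xp : bit (x 1 cpen) = false by move: (nj cpen); rewrite cpen_clast.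
have Wt z : (z + delta_mx 0 clast \in W1 n.+2) = (z \in W1 n.+2).
  by rewrite !inE; apply: eq_forallb => k; rewrite !mxE addr0.
have nf z : z \in W1 n.+2 -> flip x z = false.
  by rewrite mem_W1 => /and3P[_ /negPf zp _]; rewrite /flip xp zp !andbF.
apply: (@sum_antisym _ _ _ (+%R^~ (delta_mx 0 clast))); [exact: addIr | exact: Wt |].
move=> z zW; rewrite /nadj !nf ?Wt // !addbF bitQ_translate ?Q_delta //.
move: zW; rewrite !Bform_delta0 xl mem_W1 => /and3P[_ _ /negPf ->].
by rewrite addbF addbT; case: (bit (Q _)).
Qed.

Lemma pair_sum_translate x y t : Q t = 0 -> bit (Bform (x + y) t) ->
  (forall z, flip x (z + t) (+) flip y (z + t) = flip x z (+) flip y z) ->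
  \sum_z (-1) ^+ (nadj x z (+) nadj y z) = 0 :> int.
Proof.
move=> Qt; rewrite BformDl bitD => Bt eqf.
apply: (@sum_antisym _ _ _ (+%R^~ t)) => //; first exact: addIr.
move=> z _; rewrite /nadj addbACA eqf [in RHS]addbACA !bitQ_translate //.
move: Bt; case: (bit (Bform x t)) (bit (Bform y t)) (bit (Bform z t)) => [] [] [] // _;
by case: (bit (Q (x + z))) (bit (Q (y + z))) => [] [];
  case: (flip x z (+) flip y z).
Qed.

Definition exceptional x y :=
  [&& short_row x, short_row y, ~~ (bit (x 1 cpen) (+) bit (y 1 cpen)),
      bit (x 1 clast) (+) bit (y 1 clast) & bit (x 0 clast) (+) bit (y 0 clast)].

(** The conditions on [short_row] and [cpen] are common factors of both flips, and conjunction
    distributes over [(+)]. *)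
Lemma flip_addb x y z : short_row x -> short_row y ->
  bit (x 1 cpen) = bit (y 1 cpen) ->
  flip x z (+) flip y z =
  [&& short_row z, bit (x 1 cpen) (+) bit (z 1 cpen)
    & ((bit (x 1 clast) (+) bit (y 1 clast)) && ~~ bit (z 1 clast))
      (+) ((bit (x 0 clast) (+) bit (y 0 clast)) && ~~ bit (z 0 clast))].
Proof.
move=> Kx Ky xyp; rewrite /flip Kx Ky -xyp /=.
case: (short_row z) (bit (x 1 cpen) (+) bit (z 1 cpen)) => [] [] //=.
case: (bit (x 1 clast)) (bit (z 1 clast)) (bit (x 0 clast)) (bit (z 0 clast))
  => [] [] [] [];
by case: (bit (y 1 clast)) (bit (y 0 clast)) => [] [].
Qed.

Lemma pair_sum x y : x != y -> ~~ exceptional x y ->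
  \sum_z (-1) ^+ (nadj x z (+) nadj y z) = 0 :> int.
Proof.
move=> neq_xy nexc.
(* If the second rows differ outside [clast], a first-row translation there leaves each flip
   unchanged. *)
have [j|nj] := pickP (fun j => (j != clast) && (bit (x 1 j) (+) bit (y 1 j))).
  case/andP=> jl dj; apply: (@pair_sum_translate _ _ (delta_mx 0 j)).
  - by rewrite Q_delta.
  - by rewrite Bform_delta0 mxE bitD.
  - by move=> z; rewrite !flip_delta0.
have eqxy j : j != clast -> bit (x 1 j) = bit (y 1 j).
  by move=> jl; move: (nj j); rewrite jl /=; do 2!case: (bit _).
have xyp : bit (x 1 cpen) = bit (y 1 cpen) by rewrite eqxy ?cpen_clast.
have Kxy : short_row x = short_row y by apply: eq_short_row => j _ /eqxy.
(* Equal flips cancel, which leaves the orthogonality of the unswitched rows. *)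
have bent : (forall z, flip x z (+) flip y z = false) ->
    \sum_z (-1) ^+ (nadj x z (+) nadj y z) = 0 :> int.
  move=> nf; rewrite -[RHS](sum_sign_Q_pair neq_xy); apply: eq_bigr => z _.
  by rewrite /nadj addbACA nf addbF.
case: (boolP (short_row x)) => [Kx|/negPf Kx]; last first.
  by apply: bent => z; rewrite /flip -Kxy Kx.
have Ky : short_row y by rewrite -Kxy.
have fE z := flip_addb z Kx Ky xyp.
move: nexc; rewrite /exceptional Kx Ky xyp addbb /=.
(* When exactly one of the two [clast] entries differs, the flip difference does not read the
   other-row [clast] entry of [z], so that entry can be translated. *)
case dq: (bit (x 1 clast) (+) _); case dr: (bit (x 0 clast) (+) _) => //= _.
- apply: (@pair_sum_translate _ _ (delta_mx 0 clast)) => [||z].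
  + by rewrite Q_delta.
  + by rewrite Bform_delta0 mxE bitD.
  rewrite !fE dq dr (@eq_short_row (z + _) z) => [|k _ _]; rewrite !mxE ?addr0 //.
- apply: (@pair_sum_translate _ _ (delta_mx 1 clast)) => [||z].
  + by rewrite Q_delta.
  + by rewrite Bform_delta1 mxE bitD.
  rewrite !fE dq dr (@eq_short_row (z + _) z) => [|k _ kl]; rewrite !mxE ?addr0 //.
  + by rewrite cpen_clast /= !addr0.
  + by rewrite (negPf kl) andbF addr0.
- by apply: bent => z; rewrite fE dq dr /= !andbF.
Qed.

(** The second row of [x + y] is zero outside [clast], and that column contributes 1. *)
Lemma exceptional_Q x y : exceptional x y -> bit (Q (x + y)).
Proof.
case/and5P=> Kx Ky /negPf dp dq dr.
rewrite /Q (bigD1 clast) //= big1 => [|j jl].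
  by rewrite addr0 bitM !mxE !bitD dq dr.
apply: bit_inj; rewrite bitM !mxE !bitD bit0.
have [->|jp] := eqVneq j cpen; first by rewrite dp andbF.
by rewrite (short_rowP Kx) // (short_rowP Ky) // andbF.
Qed.

Lemma exceptional_nadj x y : exceptional x y -> nadj x y.
Proof.
move=> exc; rewrite /nadj exceptional_Q //.
by case/and5P: exc => _ _ /negPf dp _ _; rewrite /flip dp !andbF.
Qed.

(** The unswitched inner product is zero, so only minus twice the sum over the set where the flips
    differ remains. On that set the sign is constant, and the set has [2 ^ n.+2] elements. *)
Lemma exceptional_sum x y : exceptional x y ->
  \sum_z (-1) ^+ (nadj x z (+) nadj y z)
  = (-1) ^+ (~~ (bit (x 0 cpen) (+) bit (y 0 cpen)
                (+) bit (y 1 clast) (+) bit (y 0 clast))) * 2 * (2 ^ n.+2)%:Z.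
Proof.
move=> exc; have Qxy := exceptional_Q exc.
have neq_xy := nadj_neq (exceptional_nadj exc).
case/and5P: exc => Kx Ky dp dq dr.
have xyp : bit (x 1 cpen) = bit (y 1 cpen) by move: dp; do 2!case: (bit _).
under eq_bigr do rewrite /nadj addbACA.
rewrite sum_sign_addb sum_sign_Q_pair //.
set c := ~~ _.
have cE z : flip x z (+) flip y z ->
    (-1) ^+ (bit (Q (x + z)) (+) bit (Q (y + z))) = (-1) ^+ (~~ c) :> int.
  rewrite (flip_addb z Kx Ky xyp) dq dr /= => /and3P[Kz dpz dqz].
  (* The exponent becomes [Q (x + y)] plus the polar form of [x + y] and [y + z], to which only
     columns [clast] and [cpen] contribute. *)
  have -> : x + z = (x + y) + (y + z) by rewrite -addrA addmxF2K.
  rewrite (QD (x + y)) !bitD Qxy.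
  rewrite /Bform (bigD1 clast) //= (bigD1 cpen) ?cpen_clast //=.
  rewrite big1 => [|j /andP[jl jp]].
    rewrite addr0 !bitD !bitM !mxE !bitD dq dr -xyp dpz addbb /= /c.
    congr (_ ^+ nat_of_bool _); move: dqz.
    case: (bit (y 1 clast)) (bit (y 0 clast)) (bit (z 1 clast)) (bit (z 0 clast))
      => [] [] [] []; rewrite //= ?andbT => _;
    by case: (bit (x 0 cpen)) (bit (y 0 cpen)) (bit (Q (y + z))) => [] [] [].
  apply: bit_inj; rewrite bitD !bitM !mxE !bitD (short_rowP Kx) // (short_rowP Ky) //.
  by rewrite (short_rowP Kz) // andbF.
rewrite (eq_bigr _ cE) sumr_const.
rewrite (_ : #|_| = (2 ^ n.+2)%N).
  by rewrite -[_ *+ (2 ^ _)]mulr_natr natz [(-1) ^+ (~~ c)]signrN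
    mulNr mulrN sub0r opprK mulrA [2 * _]mulrC.
(* The flips differ exactly when the second row of [z] is the following function of its first
   row. *)
rewrite -(card_graph (fun j r =>
  if j == cpen then 1 + x 1 cpen else if j == clast then 1 + r 0 clast else 0)).
apply: eq_card => z; rewrite inE unfold_in /= (flip_addb z Kx Ky xyp) dq dr /=.
apply/and3P/forallP => [[Kz dpz dqz] j|zf].
  case: (eqVneq j cpen) => [->|jp].
    by rewrite eqF2E bitD bit1 addbC; case: (bit _) dpz; case: (bit _).
  case: (eqVneq j clast) => [->|jl].
    rewrite mxE eqF2E bitD bit1; move: dqz.
    by case: (bit (z 1 clast)) (bit (z 0 clast)) => [] [].
  by rewrite eqF2E (short_rowP Kz).
split.
- apply/forallP=> j; apply/implyP => /andP[jp jl].
  by rewrite (eqP (zf j)) (negPf jp) (negPf jl).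
- by rewrite (eqP (zf cpen)) eqxx bitD addbCA addbb.
- rewrite (eqP (zf clast)) [clast == cpen]eq_sym cpen_clast eqxx mxE bitD.
  by case: (bit (z 0 clast)).
Qed.

(** * From sign sums to neighbour counts *)

Lemma card_mat : #|{: 'M['F_2]_(2, n.+2)}| = (2 ^ (2 * n.+2))%N.
Proof. by rewrite card_mx card_Fp. Qed.

(** The successor accounts for [x] itself, since [nadj x x] is false. *)
Lemma card_nbrs x :
  2 * (#|nbrs (@Gamma1 n.+2) x|.+1)%:Z = (2 ^ (2 * n.+2))%:Z + (2 ^ n.+2)%:Z.
Proof.
rewrite -(row_sum x) -card_mat -(sum_sign_card predT); congr (_ * _%:Z).
rewrite [RHS](cardD1 x) !inE nadjxx add1n; congr _.+1.
by apply: eq_card => z; rewrite !inE Gamma1E eq_sym.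
Qed.

(** Where both [nadj] are false one finds the common neighbours and, if [x] and [y] are adjacent,
    also [x] and [y]; hence the term [2 * Gamma1 x y]. *)
Lemma card_common_nbrs x y : x != y ->
  4 * (#|common_nbrs (@Gamma1 n.+2) x y| + 2 * Gamma1 x y)%:Z
  = (2 ^ (2 * n.+2))%:Z + 2 * (2 ^ n.+2)%:Z
    + \sum_z (-1) ^+ (nadj x z (+) nadj y z).
Proof.
move=> neq_xy; rewrite [2 * (2 ^ _)%:Z]mulr_natl mulr2n addrA -{1}(row_sum x).
rewrite -(row_sum y) -card_mat -sum_sign_card2; congr (_ * _%:Z).
rewrite [RHS](cardD1 x) [X in _ = (_ + X)%N](cardD1 y) !inE !nadjxx.
rewrite [y == x]eq_sym (negPf neq_xy) /= Gamma1E neq_xy nadjC andbT.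
rewrite mul2n -addnn addnC addnA.
congr (_ + _)%N; apply: eq_card => z; rewrite !inE !Gamma1E ![z == _]eq_sym.
by case: (x == z); case: (y == z); rewrite //= andbF.
Qed.

End Switched.

Arguments clast {n}.
Arguments cpen {n}.

Lemma expn2_double n : (2 ^ (2 * n.+2) = 4 * (2 ^ n.+1 * 2 ^ n.+1))%N.
Proof. by rewrite mul2n -addnn expnD (expnS 2 n.+1) mulnACA. Qed.

(** * The three values for non-adjacent pairs *)

Section CommonNeighbours.

Variable n : nat.
Implicit Types x y : 'M['F_2]_(2, n.+2).

Let mu := (2 ^ n.+1 * (2 ^ n.+1 + 1))%N.

Lemma common_nbrs_regular x y : x != y -> ~~ exceptional x y ->
  (#|common_nbrs (@Gamma1 n.+2) x y| + 2 * Gamma1 x y)%N = mu.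
Proof.
move=> neq_xy nexc; have := card_common_nbrs neq_xy; rewrite pair_sum // addr0.
rewrite expn2_double (expnS 2 n.+1) /mu; move: (_ + _)%N (2 ^ n.+1)%N => a b.
clear; lia.
Qed.

Lemma common_nbrs_exceptional x y : exceptional x y ->
  #|common_nbrs (@Gamma1 n.+2) x y|
  = if bit (x 0 cpen) (+) bit (y 0 cpen) (+) bit (y 1 clast) (+) bit (y 0 clast)
    then (mu + 2 ^ n.+1)%N else (mu - 2 ^ n.+1)%N.
Proof.
move=> exc; have nxy := exceptional_nadj exc.
have neq_xy := nadj_neq nxy.
have := card_common_nbrs neq_xy; rewrite exceptional_sum //.
rewrite Gamma1E nxy andbF muln0 addn0.
rewrite expn2_double (expnS 2 n.+1) /mu; move: #|_| (2 ^ n.+1)%N => a b.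
by case: (_ (+) _); rewrite /= ?expr0 ?expr1; clear; lia.
Qed.

Lemma exists_exceptional (k : bool) : exists x y,
  exceptional x y /\
  #|common_nbrs (@Gamma1 n.+2) x y|
  = if k then (mu + 2 ^ n.+1)%N else (mu - 2 ^ n.+1)%N.
Proof.
(* Paired with 0, the two [clast] entries cancel in the sign, so the [cpen] entry [k] selects the
   value. *)
pose y : 'M['F_2]_(2, n.+2) :=
  delta_mx 0 clast + delta_mx 1 clast + k%:R *: delta_mx 0 cpen.
have y1 j : y 1 j = (j == clast)%:R by rewrite !mxE /= mulr0 addr0 add0r.
have y0l : y 0 clast = 1.
  by rewrite !mxE !eqxx [clast == cpen]eq_sym cpen_clast mulr0 !addr0.
have y0p : y 0 cpen = k%:R by rewrite !mxE !eqxx cpen_clast mulr1 !add0r.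
clearbody y; have exc : exceptional 0 y.
  rewrite /exceptional !y1 y0l cpen_clast eqxx !mxE !andbT; apply/andP.
  split; apply/forallP=> j; apply/implyP=> /andP[_ jl]; first by rewrite mxE.
  by rewrite y1 (negPf jl).
exists 0, y; split=> //; rewrite (common_nbrs_exceptional exc) y0p y0l y1 eqxx mxE.
by case: (k).
Qed.

Lemma exists_nonadjacent_regular : exists x y,
  [/\ x != y, ~~ Gamma1 x y & #|common_nbrs (@Gamma1 n.+2) x y| = mu].
Proof.
(* Here [y] is in [v0 + W1] but not in [v0 + W2], and [Q y = 0]: the edge from 0 to [y] is deleted
   by the first switching and not restored by the second. *)
pose y : 'M['F_2]_(2, n.+2) := delta_mx 1 cpen + delta_mx 0 clast.
have y1 j : y 1 j = (j == cpen)%:R by rewrite !mxE /= addr0.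
have y0l : y 0 clast = 1 by rewrite !mxE !eqxx add0r.
have Qy : Q y = 0.
  by rewrite QD !Q_delta Bform_delta0 !mxE [clast == _]eq_sym cpen_clast andbF !addr0.
clearbody y; have nxy : nadj 0 y.
  rewrite /nadj add0r Qy /flip !y1 y0l eqxx [clast == cpen]eq_sym cpen_clast.
  rewrite !mxE !andbT; apply/andP.
  split; apply/forallP=> j; apply/implyP=> /andP[jp _]; first by rewrite mxE.
  by rewrite y1 (negPf jp).
have neq := nadj_neq nxy.
have nG : ~~ Gamma1 0 y by rewrite Gamma1E nxy andbF.
exists 0, y; split => //.
rewrite -[LHS]addn0 -(common_nbrs_regular neq) ?(negPf nG) //.
by rewrite /exceptional y1 eqxx mxE !andbF.
Qed.

End CommonNeighbours.

(** * The regular clique and the conclusion *)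

Lemma clique_W1 n : clique (@Gamma1 n.+2) (W1 n.+2).
Proof.
move=> x y; rewrite Gamma1E => xW yW ->; rewrite /nadj /Q big1 => [|j _]; last first.
  move: xW yW; rewrite !inE !mxE => /forallP xW /forallP yW.
  by rewrite (eqP (xW j)) (eqP (yW j)) addr0 mulr0.
move: xW yW; rewrite !mem_W1 /flip => /and3P[_ /negPf -> _] /and3P[_ /negPf -> _].
by rewrite !andbF.
Qed.

(** The signs over [W1] sum to zero, so exactly half of [W1] is adjacent to [x]. *)
Lemma W1_nbrs n (x : 'M['F_2]_(2, n.+2)) : x \notin W1 n.+2 ->
  #|nbrs (@Gamma1 n.+2) x :&: W1 n.+2| = (2 ^ n.+1)%N.
Proof.
move=> xW; have := sum_sign_card (mem (W1 n.+2)) (nadj x).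
rewrite W1_sum // addr0 card_W1 expnS => cW.
rewrite (_ : #|_ :&: _| = #|[pred z | mem (W1 n.+2) z && ~~ nadj x z]|).
  by move: #|_| (2 ^ n.+1)%N cW => a b; clear; lia.
apply: eq_card => z; rewrite !inE Gamma1E andbC /=.
by have [<-|] //= := eqVneq x z; rewrite inE in xW; rewrite (negPf xW).
Qed.

Local Close Scope ring_scope.

Theorem theorem19 (e : nat) (he : 2 <= e) :
  let mu := 2 ^ (e - 1) * (2 ^ (e - 1) + 1) in
  [/\ strictly_neumaier (@Gamma1 e),
      edge_regular (@Gamma1 e)
        (2 ^ (2 * e))
        ((2 ^ (e - 1) + 1) * (2 ^ e - 1))
        (2 * (2 ^ (e - 2) + 1) * (2 ^ (e - 1) - 1)),
      exists S : {set 'M['F_2]_(2, e)},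
        #|S| = 2 ^ e /\ regular_clique (@Gamma1 e) S (2 ^ (e - 1))
    & forall m : nat,
        (exists x y : 'M['F_2]_(2, e),
           [/\ x != y, ~~ Gamma1 x y & #|common_nbrs (@Gamma1 e) x y| = m])
        <-> [\/ m = mu - 2 ^ (e - 1), m = mu | m = mu + 2 ^ (e - 1)]].
Proof.
case: e he => [|[|n]] // _; rewrite !subSS !subn0 => mu.
have P_gt0 : 0 < 2 ^ n.+1 by rewrite expn_gt0.
have values m :
    (exists x y : 'M['F_2]_(2, n.+2),
       [/\ x != y, ~~ Gamma1 x y & #|common_nbrs (@Gamma1 n.+2) x y| = m])
    <-> [\/ m = mu - 2 ^ n.+1, m = mu | m = mu + 2 ^ n.+1].
  split=> [[x [y [neq_xy nG <-]]]|].
    have [exc|nexc] := boolP (exceptional x y).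
      by rewrite common_nbrs_exceptional //; case: ifP => _;
        [apply: Or33 | apply: Or31].
    by apply: Or32; rewrite /mu -(common_nbrs_regular neq_xy nexc) (negPf nG) addn0.
  have witness k : exists x y : 'M['F_2]_(2, n.+2), [/\ x != y, ~~ Gamma1 x y
      & #|common_nbrs (@Gamma1 n.+2) x y| = if k then mu + 2 ^ n.+1 else mu - 2 ^ n.+1].
    have [x [y [exc cn]]] := exists_exceptional n k; exists x, y.
    have nxy := exceptional_nadj exc.
    by rewrite Gamma1E nxy andbF (nadj_neq nxy).
  by case=> ->; [exact: (witness false) | exact: exists_nonadjacent_regular
                | exact: (witness true)].
have [x0 [y0 [neq0 nG0 cn0]]] := exists_nonadjacent_regular n.
have not_complete : ~ complete_graph (@Gamma1 n.+2).
  by move=> /(_ _ _ neq0); rewrite (negPf nG0).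
have rc : regular_clique (@Gamma1 n.+2) (W1 n.+2) (2 ^ n.+1).
  by split=> // [|x /W1_nbrs]; first exact: clique_W1.
have er : edge_regular (@Gamma1 n.+2) (2 ^ (2 * n.+2))
    ((2 ^ n.+1 + 1) * (2 ^ n.+2 - 1)) (2 * (2 ^ n + 1) * (2 ^ n.+1 - 1)).
  split.
  - split=> [x y|x]; first by rewrite !Gamma1E eq_sym nadjC.
    by rewrite Gamma1E eqxx.
  - exact: card_mat.
  - have /card_gt1P[x [y [xW yW neq_xy]]] : 1 < #|W1 n.+2|.
      by rewrite card_W1 expnS; lia.
    by exists x, y; apply: clique_W1.
  - move=> x; have := card_nbrs x; rewrite expn2_double (expnS 2 n.+1).
    move: #|_| (2 ^ n.+1) P_gt0 => a b; clear; nia.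
  - move=> x y Gxy.
    have [neq_xy ny] : x != y /\ ~~ nadj x y by apply/andP; rewrite -Gamma1E.
    (* Adjacent pairs are never exceptional, so they have [mu - 2] common neighbours, which is the
       stated parameter. *)
    have := common_nbrs_regular neq_xy (contra (@exceptional_nadj n x y) ny).
    rewrite Gxy expnS; move: #|_| (2 ^ n) (expn_gt0 2 n) => a b; clear; nia.
split=> //; last by exists (W1 n.+2); rewrite card_W1.
split=> //; [by do 3!eexists; exact: er | by exists (W1 n.+2), (2 ^ n.+1) |].
(* Strong regularity would identify the attained values [mu] and [mu + 2 ^ n.+1]. *)
case=> [v [k [l [nu [_ _ cn_nu]]]]].
have [|x1 [y1 [neq1 nG1 cn1]]] := (values (mu + 2 ^ n.+1)).2; first by apply: Or33.
have := cn_nu _ _ neq1 nG1; have := cn_nu _ _ neq0 nG0.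
by rewrite cn0 cn1 -/mu => <- /eqP; rewrite -{2}[mu]addn0 eqn_add2l expn_eq0.
Qed.
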